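(* Let $A$ and $B$ be unital C*-algebras and let $T\colon A\to B$ be a unital surjective linear operator which preserves the numerical radius, i.e. $\nu(Tx)=\nu(x)$ for all $x\in A$. Then $T$ is a Jordan *-isomorphism.
   Context: For an element $x$ of a unital C*-algebra $A$, the numerical radius is $\nu(x)=\sup\{|\varphi(x)| : \varphi \text{ a state of } A\}$. A Jordan *-isomorphism is a bijective linear map $S$ with $S(x^* )=S(x)^*$ and $S(x\circ y)=Sx\circ Sy$ for all $x,y$, where $x\circ y=\tfrac12(xy+yx)$. *)

(* Defs.v *)
From HB Require Import structures.
From mathcomp Require Import all_boot all_order all_algebra.
From mathcomp Require Import classical_sets reals.
From mathcomp.real_closed Require Import complex.
Set Implicit Arguments. Unset Strict Implicit. Unset Printing Implicit Defensive.
Import Order.TTheory GRing.Theory Num.Theory.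
Local Open Scope ring_scope.

Definition cabs (R : realType) (z : R[i]) : R := complex.Re `|z|.

Record is_cstar_alg (R : realType) (A : algType R[i])
    (star : A -> A) (nrm : A -> R) : Prop := CstarAlg {
  star_add : forall x y, star (x + y) = star x + star y;
  star_scale : forall (c : R[i]) x, star (c *: x) = c^* *: star x;
  star_mul : forall x y, star (x * y) = star y * star x;
  star_invol : forall x, star (star x) = x;
  nrm_eq0 : forall x, nrm x = 0 -> x = 0;
  nrm_triangle : forall x y, nrm (x + y) <= nrm x + nrm y;
  nrm_scale : forall (c : R[i]) x, nrm (c *: x) = cabs c * nrm x;
  nrm_submul : forall x y, nrm (x * y) <= nrm x * nrm y;
  nrm_cstar : forall x, nrm (star x * x) = nrm x ^+ 2;
  nrm_complete : forall u : nat -> A,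
    (forall e : R, 0 < e -> exists N, forall m n, (N <= m)%N -> (N <= n)%N ->
        nrm (u m - u n) < e) ->
    exists l : A, forall e : R, 0 < e -> exists N, forall n, (N <= n)%N ->
        nrm (u n - l) < e
}.

Definition is_state (R : realType) (A : algType R[i]) (star : A -> A)
    (phi : A -> R[i]) : Prop :=
  [/\ forall (a : R[i]) x y, phi (a *: x + y) = a * phi x + phi y,
      forall x, 0 <= phi (star x * x)
    & phi 1 = 1].

Definition numrad (R : realType) (A : algType R[i]) (star : A -> A) (x : A) : R :=
  sup [set r : R | exists phi : A -> R[i], is_state star phi /\ r = cabs (phi x)].

Definition jprod (R : realType) (A : algType R[i]) (x y : A) : A :=
  (2 : R[i])^-1 *: (x * y + y * x).

Definition jordan_star_iso (R : realType) (A B : algType R[i])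
    (starA : A -> A) (starB : B -> B) (S : A -> B) : Prop :=
  [/\ bijective S,
      forall (a : R[i]) x y, S (a *: x + y) = a *: S x + S y,
      forall x, S (starA x) = starB (S x)
    & forall x y, S (jprod x y) = jprod (S x) (S y)].

(* Main.v *)
Require Import Defs.
From HB Require Import structures.
From mathcomp Require Import all_boot all_order all_algebra.
From mathcomp Require Import boolp classical_sets reals topology normedtype sequences.
From mathcomp.real_closed Require Import complex.
From mathcomp Require Import ring lra.
From Stdlib Require Ncring Ncring_tac.
Import Order.TTheory GRing.Theory Num.Theory.
Import numFieldNormedType.Exports.
Local Open Scope ring_scope.

Set Implicit Arguments.
Unset Strict Implicit.

(** If [phi] is a state of [B], then [phi \o T] is a unital functional dominated by the
    numerical radius of [A], which forces it to be a state.  States separate the points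
    of a C*-algebra, so [T] is injective and *-preserving, and its inverse satisfies the
    same hypotheses.  Kadison's inequality [T h ^+ 2 <= T (h ^+ 2)] for selfadjoint [h],
    applied to [T] and to its inverse, gives [T (h ^+ 2) = T h ^+ 2], and polarization
    concludes.

    Kadison's inequality is the positivity of
    [\sum_l (l - n T h) T (p_l) (l - n T h) = n^2 (T (h^2) - (T h)^2) + n T (h - h^2)]
    for the Bernstein partition of unity [p_l = 'C(n, l) h^l (1 - h)^(n - l)], divided by
    [n^2] as [n] grows.

    That states separate points follows from a Hahn-Banach separation once [x^* x] is
    known to be spectrally positive.  The only consequence of completeness that is needed
    is the square root of [1 - h] for a selfadjoint [h] of norm less than one. *)

#[local] Instance nc_ring_ops (A : pzRingType) :
  @Ncring.Ring_ops A 0 1 +%R *%R (fun x y : A => x - y) -%R eq := {}.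

#[local] Instance nc_ring_pzRing (A : pzRingType) : Ncring.Ring (Ro := nc_ring_ops A).
Proof.
split; rewrite /Algebra_syntax.equality /Ncring.eq_notation.
- exact: RelationClasses.eq_equivalence.
- by move=> x y -> u v ->.
- by move=> x y -> u v ->.
- by move=> x y -> u v ->.
- by move=> x y ->.
- exact: add0r.
- exact: addrC.
- exact: addrA.
- exact: mul1r.
- exact: mulr1.
- exact: mulrA.
- exact: mulrDl.
- by move=> x y z; exact: mulrDr.
- by [].
- exact: addrN.
Qed.

Local Ltac nc_ring := rewrite ?expr2 ?mulr2n; Ncring_tac.non_commutative_ring.

Local Notation "x %:C" := (real_complex _ x) : ring_scope.

Lemma bernoulli_inequality (R : realDomainType) (d : R) n :
  0 <= d -> 1 + d *+ n <= (1 + d) ^+ n.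
Proof.
move=> d_ge0; elim: n => [|n IHn]; first by rewrite expr0 mulr0n addr0.
rewrite exprS; apply: le_trans (ler_wpM2l _ IHn); last by rewrite addr_ge0.
rewrite mulrSr mulrDl mul1r mulrDr mulr1 addrA lerD2l lerDl.
by rewrite mulr_ge0 // mulrn_wge0.
Qed.

Lemma ge0_of_affine_ge0 (R : archiRealFieldType) (a b : R) :
  (forall n, 0 <= a *+ n.+1 + b) -> 0 <= a.
Proof.
move=> affine_ge0; rewrite leNgt; apply/negP => a_lt0.
have := affine_ge0 (Num.truncn (b / - a)); have := truncnS_gt (b / - a).
by rewrite ltr_pdivrMr ?oppr_gt0 // mulrN mulr_natl; lra.
Qed.

Lemma complex_ge0_of_affine_ge0 (R : realType) (z w : R[i]) :
  (forall n, 0 <= z *+ n.+1 + w) -> 0 <= z.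
Proof.
move=> affine_ge0; have Im_affine n := ger0_Im (affine_ge0 n).
have Im_z : complex.Im z = 0.
  have := Im_affine 0%N; have := Im_affine 1%N.
  by rewrite !raddfD /= !raddfMn /=; lra.
rewrite lecE Im_z eqxx /=; apply: (@ge0_of_affine_ge0 _ _ (complex.Re w)) => n.
by have := affine_ge0 n; rewrite lecE !raddfD /= !raddfMn => /andP[].
Qed.

Lemma le1_of_exprn_le_affine (R : archiRealFieldType) (x a b : R) :
  (forall n, x ^+ n <= a + b *+ n) -> x <= 1.
Proof.
move=> le_affine; rewrite leNgt; apply/negP => x_gt1.
have [d_ge0 xE] : 0 <= x - 1 /\ x = 1 + (x - 1) by split; lra.
suff : 0 <= - (x - 1) ^+ 2 by rewrite oppr_ge0 leNgt exprn_gt0 // subr_gt0.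
apply: (@ge0_of_affine_ge0 _ _ (`|a| + 2 * `|b|)) => n.
move: n.+1 (ltn0Sn n) => m m_gt0.
have m_ge1 : 1 <= m%:R :> R by rewrite ler1n.
have quadratic : (1 + m%:R * (x - 1)) ^+ 2 <= a + m%:R * 2 * b.
  rewrite mulr_natl -natrM mulr_natl; apply: le_trans (le_affine _).
  rewrite exprM ler_sqr ?nnegrE.
  - by rewrite {2}xE; exact: bernoulli_inequality.
  - by rewrite addr_ge0 // mulrn_wge0.
  - by rewrite exprn_ge0 //; lra.
rewrite -[_ *+ m]mulr_natl -(pmulr_rge0 _ (lt_le_trans ltr01 m_ge1)).
have a_le : a <= m%:R * `|a|.
  by apply: le_trans (ler_norm a) _; rewrite ler_peMl.
have b_le : m%:R * b <= m%:R * `|b| by rewrite ler_wpM2l ?ler_norm //; lra.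
have : 0 <= m%:R * (x - 1) by rewrite mulr_ge0 //; lra.
by move: (m%:R) quadratic a_le b_le => M; lra.
Qed.

(* The disc of center [c / 2 - i t] has [0] and [c] on its boundary. *)
Lemma in_segment_of_in_discs (R : realFieldType) (a b c : R) : 0 <= c ->
  (forall t, (a - c / 2) ^+ 2 + (b + t) ^+ 2 <= (c / 2) ^+ 2 + t ^+ 2) ->
  b = 0 /\ 0 <= a <= c.
Proof.
move=> c_ge0 discs; have b_eq0 : b = 0.
  have [//|b_neq0] := eqVneq b 0; set t := ((c / 2) ^+ 2 + 1) / (2 * b).
  have bt : 2 * b * t = (c / 2) ^+ 2 + 1 by rewrite /t; field.
  have := sqr_ge0 (a - c / 2); have := sqr_ge0 b.
  by have := discs t; rewrite (sqrrD b t) -[b * t *+ 2]mulr_natl mulrA bt; lra.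
have prod_ge0 : 0 <= a * (c - a) by have := discs 0; rewrite b_eq0; lra.
by split=> //; apply/andP; split; nra.
Qed.

(** * Separation by convex cones *)

Section Cones.
Local Open Scope classical_set_scope.

Lemma Zorn_bigcup_above (T : Type) (P : set (set T)) (A : set T) : P A ->
    (forall F : set (set T), F !=set0 -> F `<=` P -> total_on F subset ->
      P (\bigcup_(X in F) X)) ->
  exists B, [/\ P B, A `<=` B & forall C, B `<` C -> ~ P C].
Proof.
move=> PA P_chain; have [|B [PAB maxB]] := @Zorn_bigcup T [set X | P (A `|` X)].
  move=> F FP F_total; have [->|F_neq0] := eqVneq F set0.
    by rewrite bigcup_set0 /= setU0.
  have -> : [set X | P (A `|` X)] (\bigcup_(X in F) X) =
      P (\bigcup_(X in [set A `|` X | X in F]) X).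
    congr P; rewrite bigcup_image.
    have /set0P[X FX] := F_neq0; rewrite eqEsubset; split=> [z|z].
    - by case=> [Az|[Y FY Yz]]; [exists X => //; left|exists Y => //; right].
    - by case=> Y FY [Az|Yz]; [left|right; exists Y].
  apply: P_chain.
  - by have /set0P[X FX] := F_neq0; exists (A `|` X), X.
  - by move=> _ [X FX <-]; exact: FP.
  - move=> _ _ [X FX <-] [Y FY <-].
    by have [XY|YX] := F_total X Y FX FY; [left|right]; apply: setUS.
exists (A `|` B); split=> // C ABC PC.
have AC : A `|` C = C by apply/setUidPr; apply: subset_trans (properW ABC).
apply: (maxB C); last by rewrite /= AC.
split=> [z Bz|CB]; first by apply: (properW ABC); right.
by case: ABC => _; apply=> z Cz; right; exact: CB.
Qed.

Variables (R : realType) (V : lmodType R).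
Implicit Types (K C : set V) (F : set (set V)) (x y e h : V) (s t : R).

Definition convex_cone C :=
  (forall x y, C x -> C y -> C (x + y)) /\
  (forall t x, 0 <= t -> C x -> C (t *: x)).

Definition cone_adjoin C x :=
  [set z | exists t y, [/\ 0 <= t, C y & z = y + t *: x]].

Lemma convex_cone0 C x : convex_cone C -> C x -> C 0.
Proof. by move=> [_ CZ] /(CZ 0); rewrite scale0r; apply. Qed.

Lemma sub_cone_adjoin C x : C `<=` cone_adjoin C x.
Proof. by move=> y Cy; exists 0, y; rewrite scale0r addr0. Qed.

Lemma mem_cone_adjoin C x : C 0 -> cone_adjoin C x x.
Proof. by move=> C0; exists 1, 0; rewrite scale1r add0r. Qed.

Lemma convex_cone_adjoin C x : convex_cone C -> convex_cone (cone_adjoin C x).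
Proof.
move=> [CD CZ]; split=> [_ _ [s [y [s_ge0 Cy ->]]] [t [z [t_ge0 Cz ->]]]|].
  by exists (s + t), (y + z); split; [exact: addr_ge0|exact: CD|rewrite scalerDl addrACA].
move=> s _ s_ge0 [t [y [t_ge0 Cy ->]]].
by exists (s * t), (s *: y); split; [exact: mulr_ge0|exact: CZ|rewrite scalerDr scalerA].
Qed.

Lemma convex_cone_bigcup F :
  F `<=` convex_cone -> total_on F subset -> convex_cone (\bigcup_(X in F) X).
Proof.
move=> Fcone F_total; split=> [x y [X FX Xx] [Y FY Yy]|t x t_ge0 [X FX Xx]].
  have [XY|YX] := F_total _ _ FX FY.
  - by exists Y => //; apply: (Fcone _ FY).1 => //; exact: XY.
  - by exists X => //; apply: (Fcone _ FX).1 => //; exact: YX.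
by exists X => //; apply: (Fcone _ FX).2.
Qed.

Lemma maximal_cone_total C e : convex_cone C -> C 0 -> ~ C (- e) ->
    (forall D, C `<` D -> convex_cone D -> D (- e)) ->
  forall x, C x \/ C (- x).
Proof.
move=> coneC C0 Ce maxC x.
have adjoin_unit z : ~ C z -> cone_adjoin C z (- e).
  move=> Cz; apply: maxC; last exact: convex_cone_adjoin.
  by split=> [|sub]; [exact: sub_cone_adjoin|apply/Cz/sub/mem_cone_adjoin].
have [|/adjoin_unit[s [y [s_ge0 Cy ey]]]] := pselect (C x); first by left.
have [|/adjoin_unit[t [z [t_ge0 Cz ez]]]] := pselect (C (- x)); first by right.
have t_gt0 : 0 < t.
  rewrite lt_neqAle t_ge0 andbT; apply/eqP => t_eq0.
  by apply: Ce; rewrite ez -t_eq0 scale0r addr0.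
case: Ce.
have -> : - e = (s + t)^-1 *: (t *: y + s *: z).
  have -> : t *: y + s *: z = (s + t) *: - e.
    rewrite scalerDl {1}ez {1}ey !scalerDr !scalerN !scalerA [s * t]mulrC.
    by rewrite addrACA addNr addr0 addrC.
  by rewrite scalerK // gt_eqF // ltr_wpDl.
apply: coneC.2; first by rewrite invr_ge0 addr_ge0.
by apply: coneC.1; apply: coneC.2.
Qed.

Lemma maximal_cone K e : convex_cone K -> K 0 -> ~ K (- e) ->
  exists C, [/\ convex_cone C, K `<=` C, ~ C (- e) & forall x, C x \/ C (- x)].
Proof.
move=> coneK K0 Ke.
have [//||C [[coneC Ce] KC maxC]] :=
    @Zorn_bigcup_above _ [set C | convex_cone C /\ ~ C (- e)] K.
  move=> F _ FP F_total; split.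
    by apply: convex_cone_bigcup => // X /FP[].
  by move=> [X /FP[_ Xe]].
exists C; split=> //; apply: (@maximal_cone_total C e) => //; first exact: KC.
by move=> D CD coneD; apply: contrapT => De; apply: (maxC D CD).
Qed.

Section HalfSpaceGauge.
Variables (C : set V) (e : V).
Hypotheses (coneC : convex_cone C) (Ce : C e) (CNe : ~ C (- e)).
Hypotheses (totalC : forall x, C x \/ C (- x)).
Hypothesis (unitC : forall x, exists t, C (t *: e - x)).

Definition cone_gauge x := inf [set t | C (t *: e - x)].

Let CD := coneC.1.
Let CZ := coneC.2.

Lemma cone_unit_ge0 t : C (t *: e) -> 0 <= t.
Proof.
move=> Ct; rewrite leNgt; apply/negP => t_lt0; apply: CNe.
have -> : - e = (- t^-1) *: (t *: e) by rewrite scaleNr scalerK ?lt_eqF.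
by apply: CZ => //; rewrite oppr_ge0 invr_le0 ltW.
Qed.

Lemma has_inf_cone_gauge x : has_inf [set t | C (t *: e - x)].
Proof.
split; first exact: unitC.
have [s Cs] := unitC (- x); exists (- s) => t Ct.
rewrite -subr_ge0 opprK; apply: cone_unit_ge0.
by have := CD Ct Cs; rewrite opprK addrACA addNr addr0 -scalerDl.
Qed.

Lemma cone_gauge_le t x : C (t *: e - x) -> cone_gauge x <= t.
Proof. exact: (ge_inf (has_inf_cone_gauge x).2). Qed.

Lemma cone_gauge_lt t x : cone_gauge x < t -> C (t *: e - x).
Proof.
move=> lt_t; have gap_gt0 : 0 < t - cone_gauge x by rewrite subr_gt0.
have [s Cs] := inf_adherent gap_gt0 (has_inf_cone_gauge x).
rewrite -/(cone_gauge x) addrC subrK => lt_s.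
have /CZ/(_ Ce) : 0 <= t - s by rewrite subr_ge0 ltW.
by move=> /CD/(_ Cs); rewrite addrA -scalerDl subrK.
Qed.

Lemma cone_gaugeD_le x y : cone_gauge (x + y) <= cone_gauge x + cone_gauge y.
Proof.
apply/ler_addgt0Pr => d d_gt0; have d2_gt0 : 0 < d / 2 by rewrite divr_gt0.
have := @cone_gauge_lt (cone_gauge y + d / 2) y; rewrite ltrDl => /(_ d2_gt0).
have := @cone_gauge_lt (cone_gauge x + d / 2) x; rewrite ltrDl => /(_ d2_gt0).
move=> /CD/[apply]; rewrite addrACA -opprD -scalerDl => /cone_gauge_le; lra.
Qed.

Lemma cone_gaugeZ_le t x : 0 <= t -> cone_gauge (t *: x) <= t * cone_gauge x.
Proof.
move=> t_ge0; apply/ler_addgt0Pr => d d_gt0.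
have d1_gt0 : 0 < d / (t + 1) by rewrite divr_gt0 //; lra.
have := @cone_gauge_lt (cone_gauge x + d / (t + 1)) x; rewrite ltrDl => /(_ d1_gt0).
move=> /(CZ t_ge0); rewrite scalerBr scalerA => /cone_gauge_le /le_trans; apply.
by rewrite mulrDr lerD2l mulrCA ger_pMr // ler_pdivrMr; lra.
Qed.

(* Totality of [C] makes the sublinear gauge odd, hence linear. *)
Lemma cone_gaugeN x : cone_gauge (- x) = - cone_gauge x.
Proof.
have gauge0_ge0 : 0 <= cone_gauge 0.
  by apply: lb_le_inf (unitC 0) _ => t /=; rewrite subr0; exact: cone_unit_ge0.
have := cone_gaugeD_le x (- x); rewrite subrr => gauge_sum_ge0.
suff : cone_gauge (- x) <= - cone_gauge x by lra.
apply/ler_addgt0Pr => d d_gt0; have -> : - cone_gauge x + d = - (cone_gauge x - d) by lra.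
apply: cone_gauge_le; rewrite scaleNr -opprD.
by have [/cone_gauge_le|//] := totalC ((cone_gauge x - d) *: e - x); lra.
Qed.

Lemma cone_gauge_is_scalar : scalar cone_gauge.
Proof.
have gaugeZ t x : 0 <= t -> cone_gauge (t *: x) = t * cone_gauge x.
  move=> t_ge0; apply/eqP; rewrite eq_le cone_gaugeZ_le //=.
  by have := @cone_gaugeZ_le t (- x) t_ge0; rewrite scalerN !cone_gaugeN mulrN lerN2.
have gaugeD x y : cone_gauge (x + y) = cone_gauge x + cone_gauge y.
  apply/eqP; rewrite eq_le cone_gaugeD_le /=.
  by have := cone_gaugeD_le (- x) (- y); rewrite -opprD !cone_gaugeN -opprD lerN2.
move=> t x y; rewrite gaugeD; congr (_ + _).
have [/gaugeZ//|t_lt0] := leP 0 t.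
by apply: oppr_inj; rewrite -cone_gaugeN -scaleNr gaugeZ ?mulNr // oppr_ge0 ltW.
Qed.

Lemma cone_gauge_ge0 x : C x -> 0 <= cone_gauge x.
Proof.
move=> Cx; rewrite -oppr_le0 -cone_gaugeN; apply: cone_gauge_le.
by rewrite opprK scale0r add0r.
Qed.

Lemma cone_gauge_unit : cone_gauge e = 1.
Proof.
have C0 : C 0 := convex_cone0 coneC Ce.
apply/eqP; rewrite eq_le cone_gauge_le ?scale1r ?subrr //=.
by rewrite -lerN2 -cone_gaugeN cone_gauge_le // scaleN1r subrr.
Qed.

End HalfSpaceGauge.

(* The cone generated by [K] and [- h] is enlarged to a maximal cone omitting [- e];
   such a cone is a half-space, and the functional is its gauge. *)
Lemma cone_separation K e h : convex_cone K -> K e ->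
    (forall x, exists t, K (t *: e - x)) -> ~ K h ->
  exists f : {scalar V}, [/\ forall x, K x -> 0 <= f x, f e = 1 & f h <= 0].
Proof.
move=> coneK Ke unitK Kh; have K0 := convex_cone0 coneK Ke.
have KNe : ~ K (- e).
  move=> KNe; apply: Kh; have [t] := unitK (- h); rewrite opprK => Kt.
  have Kabs : K (`|t| *: e - t *: e).
    by rewrite -scalerBl; apply: coneK.2 => //; rewrite subr_ge0 ler_norm.
  have := coneK.1 _ _ (coneK.2 _ _ (normr_ge0 t) KNe) (coneK.1 _ _ Kabs Kt).
  by rewrite scalerN subrKA addKr.
have adjoinNe : ~ cone_adjoin K (- h) (- e).
  move=> [t [y [t_ge0 Ky ey]]]; have [t_eq0|t_neq0] := eqVneq t 0.
    by apply: KNe; rewrite ey t_eq0 scale0r addr0.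
  apply: Kh; have -> : h = t^-1 *: (y + e).
    rewrite -[y](addrK (t *: - h)) -ey scalerN opprK addrAC addNr add0r.
    by rewrite scalerK.
  by apply: coneK.2; [rewrite invr_ge0|apply: coneK.1].
have [C [coneC KC CNe totalC]] :=
  maximal_cone (convex_cone_adjoin (- h) coneK) (sub_cone_adjoin _ K0) adjoinNe.
have subC : K `<=` C := subset_trans (@sub_cone_adjoin K (- h)) KC.
have unitC x : exists t, C (t *: e - x) by have [t Kt] := unitK x; exists t; exact: subC.
have gauge_scalar := cone_gauge_is_scalar coneC (subC _ Ke) CNe totalC unitC.
pose f : {scalar V} := HB.pack (cone_gauge C e)
  (GRing.isLinear.Build R V R *%R (cone_gauge C e) gauge_scalar).
exists f; split=> [x Kx||].
- by apply: cone_gauge_ge0 => //; exact: subC.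
- by apply: cone_gauge_unit => //; exact: subC.
- rewrite -oppr_ge0 -raddfN; apply: cone_gauge_ge0 => //; first exact: subC.
  exact/KC/mem_cone_adjoin.
Qed.

End Cones.

Section RealScalars.
Variables (R : rcfType) (V : lmodType R[i]).

Definition real_scalars : Type := V.

HB.instance Definition _ := GRing.Zmodule.on real_scalars.

Let real_scale (t : R) (x : real_scalars) : real_scalars := t%:C *: (x : V).

Let real_scaleA s t x : real_scale s (real_scale t x) = real_scale (s * t) x.
Proof. by rewrite /real_scale scalerA -rmorphM. Qed.

Let real_scale1 : left_id 1 real_scale.
Proof. by move=> x; rewrite /real_scale rmorph1 scale1r. Qed.

Let real_scaleDr : right_distributive real_scale +%R.
Proof. by move=> t x y; rewrite /real_scale scalerDr. Qed.

Let real_scaleDl x : {morph real_scale^~ x : s t / s + t}.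
Proof. by move=> s t; rewrite /real_scale rmorphD scalerDl. Qed.

HB.instance Definition _ := GRing.Zmodule_isLmodule.Build R real_scalars
  real_scaleA real_scale1 real_scaleDr real_scaleDl.

Definition complex_extension (f : real_scalars -> R) (x : V) : R[i] :=
  (f x +i* (- f ('i%C *: x)))%C.

Lemma complex_extension_is_scalar (f : {scalar real_scalars}) :
  scalar (complex_extension f).
Proof.
have fZ (t : R) (x : V) : f (t%:C *: x) = t * f x.
  exact: (linearZ_LR f).
have fD (x y : V) : f (x + y) = f x + f y.
  exact: (linearD f).
move=> [s t] x y; have split_scalar : (s +i* t)%C = s%:C + t%:C * 'i%C :> R[i].
  by rewrite [LHS]complexE mulrC.
have f_re : f ((s +i* t)%C *: x) = s * f x + t * f ('i%C *: x).
  by rewrite split_scalar scalerDl -scalerA fD !fZ.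
have f_im : f ('i%C *: ((s +i* t)%C *: x)) = s * f ('i%C *: x) - t * f x.
  rewrite scalerA mulrC -scalerA split_scalar scalerDl -scalerA fD !fZ.
  by rewrite scalerA -expr2 sqr_i scaleN1r [f (- x)](linearN f) mulrN.
rewrite /complex_extension scalerDr !fD f_re f_im.
by apply/eqP; rewrite eq_complex /=; apply/andP; split; apply/eqP; ring.
Qed.

End RealScalars.

(** * C*-algebras *)

Section ComplexScalars.
Variable R : realType.
Implicit Types (z w : R[i]) (t : R).

Lemma cabsE z : (cabs z)%:C = `|z|.
Proof. exact: RRe_real (normr_real z). Qed.

Lemma cabs_real t : cabs t%:C = `|t|.
Proof. by rewrite /cabs normc_def /= expr0n /= addr0 sqrtr_sqr. Qed.

Lemma cabs_sqr z : cabs z ^+ 2 = complex.Re z ^+ 2 + complex.Im z ^+ 2.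
Proof. by rewrite /cabs normc_def /= sqr_sqrtr // addr_ge0 // sqr_ge0. Qed.

Lemma cabs_ge0 z : 0 <= cabs z.
Proof. by rewrite -lecR cabsE normr_ge0. Qed.

Lemma cabs_i : cabs ('i%C : R[i]) = 1.
Proof. by rewrite /cabs normc_def /= expr0n add0r expr1n sqrtr1. Qed.

Lemma cabs_eq0 z : cabs z = 0 -> z = 0.
Proof. by move=> z0; apply: normr0_eq0; rewrite -cabsE z0. Qed.

Lemma conj_imaginary : 'i%C^* = - 'i%C :> R[i].
Proof. by apply/eqP; rewrite eq_complex /= oppr0 !eqxx. Qed.

Lemma scale_half_double (V : lmodType R[i]) (x : V) :
  (2^-1 : R)%:C *: (x + x) = x.
Proof.
rewrite scalerDr -scalerDl -rmorphD.
by rewrite (_ : 2^-1 + 2^-1 = 1 :> R) ?rmorph1 ?scale1r //; lra.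
Qed.

End ComplexScalars.

Lemma commrZ (K : pzRingType) (A : algType K) (c : K) (x y : A) :
  GRing.comm x y -> GRing.comm x (c *: y).
Proof. by rewrite /GRing.comm -scalerAl -scalerAr => ->. Qed.

Definition selfadjoint (A : Type) (star : A -> A) x := star x = x.

Section CstarAlgebra.
Local Open Scope classical_set_scope.
Variables (R : realType) (A : algType R[i]) (star : A -> A) (nrm : A -> R).
Hypothesis hA : is_cstar_alg star nrm.
Local Notation I := ('i%C : R[i]).
Local Notation sa := (selfadjoint star).
Implicit Types (a b g h p v w x y : A) (u : nat -> A) (r s t e : R).

Lemma starD x y : star (x + y) = star x + star y.
Proof. exact: star_add hA x y. Qed.

Lemma starZ (c : R[i]) x : star (c *: x) = c^* *: star x.
Proof. exact: star_scale hA c x. Qed.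

Lemma starM x y : star (x * y) = star y * star x.
Proof. exact: star_mul hA x y. Qed.

Lemma starK : involutive star.
Proof. exact: star_invol hA. Qed.

Lemma starN x : star (- x) = - star x.
Proof. by rewrite -[- x]scaleN1r starZ rmorphN rmorph1 scaleN1r. Qed.

Lemma starB x y : star (x - y) = star x - star y.
Proof. by rewrite starD starN. Qed.

Lemma starZr t x : star (t%:C *: x) = t%:C *: star x.
Proof. by rewrite starZ [t%:C^*]conjc_real. Qed.

Lemma starZi x : star (I *: x) = - (I *: star x).
Proof. by rewrite starZ conj_imaginary scaleNr. Qed.

Lemma star1 : star 1 = 1.
Proof.
by rewrite -[LHS]mulr1; apply: (can_inj starK); rewrite starM starK mulr1.
Qed.

Lemma star0 : star 0 = 0.
Proof. by rewrite -{1}(subrr (0 : A)) starB subrr. Qed.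

Lemma starX x n : star (x ^+ n) = star x ^+ n.
Proof. by elim: n => [|n IHn]; rewrite ?expr0 ?star1 // exprS starM IHn -exprSr. Qed.

Lemma scaleII x : I *: (I *: x) = - x.
Proof. by rewrite scalerA -expr2 sqr_i scaleN1r. Qed.

Lemma mulrn_scale x n : x *+ n = (n%:R : R)%:C *: x.
Proof. by rewrite rmorph_nat scaler_nat. Qed.

Lemma constD s t : (s + t)%:C%:A = s%:C%:A + t%:C%:A :> A.
Proof. by rewrite rmorphD scalerDl. Qed.

Lemma constB s t : (s - t)%:C%:A = s%:C%:A - t%:C%:A :> A.
Proof. by rewrite rmorphB scalerBl. Qed.

Lemma const1 : (1 : R)%:C%:A = 1 :> A.
Proof. by rewrite rmorph1 scale1r. Qed.

Lemma comm_const t x : GRing.comm x t%:C%:A.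
Proof. exact/commrZ/commr1. Qed.

Lemma nrmZr t x : nrm (t%:C *: x) = `|t| * nrm x.
Proof. by rewrite (nrm_scale hA) cabs_real. Qed.

Lemma nrmZi x : nrm (I *: x) = nrm x.
Proof. by rewrite (nrm_scale hA) cabs_i mul1r. Qed.

Lemma nrm0 : nrm 0 = 0.
Proof. by rewrite -(scaler0 _ (0 : R)%:C) nrmZr normr0 mul0r. Qed.

Lemma nrmN x : nrm (- x) = nrm x.
Proof. by rewrite -scaleN1r -(rmorph1 (real_complex R)) -rmorphN nrmZr normrN1 mul1r. Qed.

Lemma nrmD x y : nrm (x + y) <= nrm x + nrm y.
Proof. exact: nrm_triangle hA x y. Qed.

Lemma nrmB x y : nrm (x - y) <= nrm x + nrm y.
Proof. by rewrite -(nrmN y) nrmD. Qed.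

Lemma nrm_ge0 x : 0 <= nrm x.
Proof. by have := nrmB x x; rewrite subrr nrm0; lra. Qed.

Lemma nrmM x y : nrm (x * y) <= nrm x * nrm y.
Proof. exact: nrm_submul hA x y. Qed.

Lemma nrm1 : nrm 1 = 1.
Proof.
have nrm1_neq0 : nrm 1 != 0 by apply/eqP => /(nrm_eq0 hA) /eqP; rewrite oner_eq0.
by apply: (mulfI nrm1_neq0); rewrite mulr1 -expr2 -(nrm_cstar hA) star1 mulr1.
Qed.

Lemma nrm_const t : nrm t%:C%:A = `|t|.
Proof. by rewrite nrmZr nrm1 mulr1. Qed.

Lemma nrmMn x n : nrm (x *+ n) = nrm x *+ n.
Proof. by rewrite mulrn_scale nrmZr ger0_norm // mulr_natl. Qed.

Lemma nrm_star x : nrm (star x) = nrm x.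
Proof.
suff le_nrm_star y : nrm y <= nrm (star y).
  by apply/eqP; rewrite eq_le le_nrm_star -{2}(starK x) le_nrm_star.
have := nrmM (star y) y; rewrite (nrm_cstar hA) expr2.
have [->|y_neq0] := eqVneq (nrm y) 0; first by rewrite nrm_ge0.
by rewrite ler_pM2r // lt_neqAle eq_sym y_neq0 nrm_ge0.
Qed.

Lemma nrmX_le x n : nrm (x ^+ n) <= nrm x ^+ n.
Proof.
elim: n => [|n IHn]; first by rewrite !expr0 nrm1.
by rewrite !exprS; apply: le_trans (nrmM _ _) _; rewrite ler_wpM2l ?nrm_ge0.
Qed.

Lemma nrm_sqrB x y : nrm (x * x - y * y) <= (nrm x + nrm y) * nrm (x - y).
Proof.
have -> : x * x - y * y = x * (x - y) + (x - y) * y by nc_ring.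
have := nrmD (x * (x - y)) ((x - y) * y); have := nrmM x (x - y).
by have := nrmM (x - y) y; lra.
Qed.

Lemma homogeneous_unit_ball (P : A -> Prop) :
    (forall t x, 0 <= t -> P x -> P (t%:C *: x)) ->
    (forall x, nrm x < 1 -> P x) ->
  forall x, P x.
Proof.
move=> PZ P_ball x; set r := nrm x + 1.
have r_gt0 : 0 < r by rewrite ltr_wpDl ?nrm_ge0.
have -> : x = r%:C *: (r^-1%:C *: x).
  by rewrite scalerA -rmorphM mulfV ?gt_eqF // rmorph1 scale1r.
apply: PZ; [exact: ltW|apply: P_ball].
by rewrite nrmZr ger0_norm ?invr_ge0 ?ltW // mulrC ltr_pdivrMr // mul1r ltrDl.
Qed.

Lemma selfadjointD x y : sa x -> sa y -> sa (x + y).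
Proof. by rewrite /selfadjoint starD => -> ->. Qed.

Lemma selfadjointN x : sa x -> sa (- x).
Proof. by rewrite /selfadjoint starN => ->. Qed.

Lemma selfadjointB x y : sa x -> sa y -> sa (x - y).
Proof. by move=> sax say; apply/selfadjointD/selfadjointN. Qed.

Lemma selfadjointZ t x : sa x -> sa (t%:C *: x).
Proof. by rewrite /selfadjoint starZr => ->. Qed.

Lemma selfadjointMn x n : sa x -> sa (x *+ n).
Proof. by move=> sax; rewrite mulrn_scale; exact: selfadjointZ. Qed.

Lemma selfadjointM x y : GRing.comm x y -> sa x -> sa y -> sa (x * y).
Proof. by rewrite /selfadjoint starM => -> -> ->. Qed.

Lemma selfadjointX x n : sa x -> sa (x ^+ n).
Proof. by rewrite /selfadjoint starX => ->. Qed.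

Lemma selfadjoint1 : sa 1.
Proof. exact: star1. Qed.

Lemma selfadjoint_const t : sa t%:C%:A.
Proof. exact: selfadjointZ selfadjoint1. Qed.

Lemma selfadjoint_sqr x : sa x -> sa (x * x).
Proof. by move=> sax; apply: selfadjointM. Qed.

Lemma selfadjoint_star_mul x : sa (star x * x).
Proof. by rewrite /selfadjoint starM starK. Qed.

Lemma nrm_sqr x : sa x -> nrm (x * x) = nrm x ^+ 2.
Proof. by move=> sax; rewrite -(nrm_cstar hA) sax. Qed.

Lemma nrmX x n : sa x -> nrm (x ^+ n) = nrm x ^+ n.
Proof.
move=> sax; have [x_eq0|x_neq0] := eqVneq (nrm x) 0.
  by rewrite x_eq0 (nrm_eq0 hA x_eq0) !expr0n; case: eqP; rewrite ?nrm1 ?nrm0.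
have nrmX2 k : nrm (x ^+ (2 ^ k)) = nrm x ^+ (2 ^ k).
  elim: k => [|k IHk]; first by rewrite expn0 !expr1.
  by rewrite expnSr !exprM expr2 nrm_sqr ?IHk //; exact: selfadjointX.
have le_2n : (n <= 2 ^ n)%N by apply/ltnW/ltn_expl.
have rest_gt0 : 0 < nrm x ^+ (2 ^ n - n).
  by rewrite exprn_gt0 // lt_neqAle eq_sym x_neq0 nrm_ge0.
apply/eqP; rewrite eq_le nrmX_le /= -(ler_pM2r rest_gt0) -exprD subnKC // -nrmX2.
rewrite -{1}(subnKC le_2n) exprD; apply: le_trans (nrmM _ _) _.
by rewrite ler_wpM2l ?nrm_ge0 ?nrmX_le.
Qed.

Definition re_part x := (2^-1 : R)%:C *: (x + star x).

Definition im_part x := re_part (- (I *: x)).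

Lemma selfadjoint_re_part x : sa (re_part x).
Proof. by apply: selfadjointZ; rewrite /selfadjoint starD starK addrC. Qed.

Lemma re_part_selfadjoint x : sa x -> re_part x = x.
Proof. by rewrite /re_part => ->; exact: scale_half_double. Qed.

Lemma re_partD x y : re_part (x + y) = re_part x + re_part y.
Proof. by rewrite /re_part starD addrACA scalerDr. Qed.

Lemma re_partZ t x : re_part (t%:C *: x) = t%:C *: re_part x.
Proof. by rewrite /re_part starZr -scalerDr !scalerA mulrC. Qed.

Lemma re_partN x : re_part (- x) = - re_part x.
Proof. by rewrite /re_part starN -opprD scalerN. Qed.

Lemma re_partB x y : re_part (x - y) = re_part x - re_part y.
Proof. by rewrite re_partD re_partN. Qed.

Lemma re_part_imaginary x : sa x -> re_part (I *: x) = 0.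
Proof. by rewrite /re_part starZi => ->; rewrite subrr scaler0. Qed.

Lemma cartesian_decomposition x : x = re_part x + I *: im_part x.
Proof.
rewrite /im_part /re_part starN starZi opprK scalerA mulrC -scalerA -scalerDr.
rewrite [I *: _]scalerDr scalerN !scaleII opprK addrACA subrr addr0.
by rewrite scale_half_double.
Qed.

Lemma star_cartesian v w : sa v -> sa w -> star (v + I *: w) = v - I *: w.
Proof. by move=> sav saw; rewrite starD starZi sav saw. Qed.

Lemma im_part_cartesian v w : sa v -> sa w -> im_part (v + I *: w) = w.
Proof.
move=> sav saw; rewrite /im_part scalerDr scaleII opprD opprK re_partD.
by rewrite (re_part_selfadjoint saw) re_partN re_part_imaginary // oppr0 add0r.
Qed.

Lemma nrm_re_part x : nrm (re_part x) <= nrm x.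
Proof.
rewrite nrmZr ger0_norm ?invr_ge0 //.
by have := nrmD x (star x); rewrite nrm_star; lra.
Qed.

Lemma nrm_im_part x : nrm (im_part x) <= nrm x.
Proof. by apply: le_trans (nrm_re_part _) _; rewrite nrmN nrmZi. Qed.

Lemma sqr_cartesian v w :
  (v + I *: w) * (v + I *: w) = v * v - w * w + I *: (v * w + w * v).
Proof.
rewrite mulrDl !mulrDr -!scalerAl -!scalerAr scaleII [I *: (_ + _)]scalerDr.
by nc_ring.
Qed.

Lemma star_mul_cartesian v w : sa v -> sa w ->
  star (v + I *: w) * (v + I *: w) = v * v + w * w + I *: (v * w - w * v).
Proof.
move=> sav saw; rewrite star_cartesian // mulrBl !mulrDr -!scalerAl -!scalerAr.
by rewrite scaleII [I *: (_ - _)]scalerBr; nc_ring.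
Qed.

Lemma mul_star_cartesian v w : sa v -> sa w ->
  (v + I *: w) * star (v + I *: w) = v * v + w * w - I *: (v * w - w * v).
Proof.
move=> sav saw; rewrite star_cartesian // mulrDl !mulrBr -!scalerAl -!scalerAr.
by rewrite scaleII [I *: (_ - _)]scalerBr; nc_ring.
Qed.

(** * Square roots *)

Definition nrm_cvg u l : Prop := nrm (u n - l) @[n --> \oo] --> 0.

Lemma nrm_cvg_dominated u l (d : nat -> R) :
  (forall n, nrm (u n - l) <= d n) -> d n @[n --> \oo] --> 0 -> nrm_cvg u l.
Proof.
move=> le_d d_cvg0; apply: squeeze_cvgr (cvg_cst 0) d_cvg0.
by apply: nearW => n; rewrite nrm_ge0 le_d.
Qed.

Lemma nrm_cvg_cst l : nrm_cvg (fun=> l) l.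
Proof. by rewrite /nrm_cvg subrr nrm0; exact: cvg_cst. Qed.

Lemma nrm_cvg_unique u l l' : nrm_cvg u l -> nrm_cvg u l' -> l = l'.
Proof.
move=> ul ul'; apply/eqP; rewrite -subr_eq0; apply/eqP/(nrm_eq0 hA)/eqP.
rewrite eq_le nrm_ge0 andbT -(addr0 0); apply: ler_cvg_to (cvg_cst _) (cvgD ul' ul) _.
apply: nearW => n; have -> : l - l' = (u n - l') - (u n - l) by nc_ring.
exact: nrmB.
Qed.

Lemma nrm_cvgS u l : nrm_cvg u l -> nrm_cvg (fun n => u n.+1) l.
Proof. by move=> ul; rewrite /nrm_cvg (cvg_shiftS (fun n => nrm (u n - l))). Qed.

Lemma nrm_cvg_star u l : nrm_cvg u l -> nrm_cvg (star \o u) (star l).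
Proof.
move=> ul; apply: nrm_cvg_dominated ul => n.
by rewrite /= -starB nrm_star.
Qed.

Lemma nrm_cvgZ t u l : nrm_cvg u l -> nrm_cvg (fun n => t%:C *: u n) (t%:C *: l).
Proof.
move=> /(cvgM (cvg_cst `|t|)); rewrite mulr0 => bound_cvg0.
by apply: nrm_cvg_dominated bound_cvg0 => n; rewrite -scalerBr nrmZr.
Qed.

Lemma nrm_cvgD u u' l l' :
  nrm_cvg u l -> nrm_cvg u' l' -> nrm_cvg (fun n => u n + u' n) (l + l').
Proof.
move=> ul ul'; apply: (@nrm_cvg_dominated _ _ (fun n => nrm (u n - l) + nrm (u' n - l'))).
  by move=> n; rewrite opprD addrACA nrmD.
by rewrite -(addr0 0); exact: cvgD.
Qed.

Lemma nrm_cvgM u u' l l' :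
  nrm_cvg u l -> nrm_cvg u' l' -> nrm_cvg (fun n => u n * u' n) (l * l').
Proof.
move=> ul ul'; apply: (@nrm_cvg_dominated _ _ (fun n =>
  nrm (u n - l) * nrm (u' n - l') + (nrm (u n - l) * nrm l' + nrm l * nrm (u' n - l'))))
  => [n|]; last first.
  have -> : 0 = 0 * 0 + (0 * nrm l' + nrm l * 0) :> R by rewrite !mulr0 mul0r !addr0.
  by apply: cvgD; [exact: cvgM|apply: cvgD; apply: cvgM => //; exact: cvg_cst].
have -> : u n * u' n - l * l' =
  (u n - l) * (u' n - l') + ((u n - l) * l' + l * (u' n - l')) by nc_ring.
apply: le_trans (nrmD _ _) (lerD (nrmM _ _) _).
by apply: le_trans (nrmD _ _) (lerD (nrmM _ _) (nrmM _ _)).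
Qed.

Lemma nrm_cvg_geometric u r : 0 <= r < 1 ->
  (forall n k, nrm (u (n + k)%N - u n) <= r ^+ n) -> exists l, nrm_cvg u l.
Proof.
move=> /andP[r_ge0 r_lt1] geometric.
have [|l u_cvg] := nrm_complete hA (u := u); last first.
  exists l; apply/cvgr0Pnorm_lt => e /u_cvg[N u_lt].
  by exists N => // n /u_lt; rewrite ger0_norm // nrm_ge0.
move=> e e_gt0; have e2_gt0 : 0 < e / 2 by rewrite divr_gt0.
have r_norm : `|r| < 1 by rewrite ger0_norm.
have /cvgr0Pnorm_lt/(_ _ e2_gt0)[N _ /(_ N (leqnn N))] := cvg_expr r_norm.
rewrite ger0_norm ?exprn_ge0 // => rN_lt; exists N => m n Nm Nn.
have -> : u m - u n = (u m - u N) - (u n - u N) by nc_ring.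
apply: le_lt_trans (nrmB _ _) _.
have := geometric N (m - N)%N; have := geometric N (n - N)%N; rewrite !subnKC //; lra.
Qed.

Section SquareRootIteration.
Variable h : A.
Hypotheses (sah : sa h) (h_lt1 : nrm h < 1).

(* If [y] is a fixed point of this contraction of the ball of radius [nrm h] then
   [(1 - y) ^+ 2 = 1 - h]. *)
Definition sqrt_step y := (2^-1 : R)%:C *: (h + y * y).

Definition sqrt_iter n := iter n sqrt_step 0.

Lemma nrm_sqrt_step x y :
  nrm x <= nrm h -> nrm y <= nrm h ->
  nrm (sqrt_step x - sqrt_step y) <= nrm h * nrm (x - y).
Proof.
move=> x_le y_le; rewrite /sqrt_step -scalerBr nrmZr ger0_norm ?invr_ge0 //.
have -> : h + x * x - (h + y * y) = x * x - y * y by nc_ring.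
have := nrm_sqrB x y.
have : (nrm x + nrm y) * nrm (x - y) <= (2 * nrm h) * nrm (x - y).
  by rewrite ler_wpM2r ?nrm_ge0 //; lra.
lra.
Qed.

Lemma nrm_sqrt_iter n : nrm (sqrt_iter n) <= nrm h.
Proof.
elim: n => [|n IHn]; first by rewrite /sqrt_iter /= nrm0 nrm_ge0.
rewrite /sqrt_iter iterS -/(sqrt_iter n) /sqrt_step nrmZr ger0_norm ?invr_ge0 //.
have := nrmD h (sqrt_iter n * sqrt_iter n).
have : nrm (sqrt_iter n) * nrm (sqrt_iter n) <= nrm h * 1.
  by apply: ler_pM; rewrite ?nrm_ge0 //; exact: le_trans IHn (ltW h_lt1).
by have := nrmM (sqrt_iter n) (sqrt_iter n); lra.
Qed.

Lemma selfadjoint_sqrt_iter n : sa (sqrt_iter n).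
Proof.
elim: n => [|n IHn]; first exact: star0.
by apply: selfadjointZ; apply: selfadjointD sah _; exact: selfadjoint_sqr.
Qed.

Lemma comm_sqrt_iter g n : GRing.comm g h -> GRing.comm g (sqrt_iter n).
Proof.
move=> gh; elim: n => [|n IHn]; first exact: commr0.
by apply/commrZ/commrD => //; exact: commrM.
Qed.

Lemma sqrt_iter_dist n k : nrm (sqrt_iter (n + k) - sqrt_iter n) <= nrm h ^+ n.
Proof.
elim: n => [|n IHn].
  by rewrite expr0 /sqrt_iter /= subr0; exact: le_trans (nrm_sqrt_iter k) (ltW h_lt1).
rewrite addSn /sqrt_iter !iterS exprS.
apply: le_trans (nrm_sqrt_step (nrm_sqrt_iter _) (nrm_sqrt_iter _)) _.
by rewrite ler_wpM2l ?nrm_ge0.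
Qed.

Lemma exists_sqrt_1B : exists w,
  [/\ sa w, w * w = 1 - h & forall g, GRing.comm g h -> GRing.comm g w].
Proof.
have h_itv : 0 <= nrm h < 1 by rewrite nrm_ge0.
have [y y_lim] := nrm_cvg_geometric h_itv sqrt_iter_dist.
have y_fixed : y = sqrt_step y.
  apply: nrm_cvg_unique (nrm_cvgS y_lim) _.
  exact: nrm_cvgZ (nrm_cvgD (nrm_cvg_cst h) (nrm_cvgM y_lim y_lim)).
exists (1 - y); split.
- apply: selfadjointB selfadjoint1 _; apply: nrm_cvg_unique (nrm_cvg_star y_lim) _.
  by rewrite (_ : star \o sqrt_iter = sqrt_iter) //; apply/funext/selfadjoint_sqrt_iter.
- have yy : y + y = h + y * y by rewrite {1 2}y_fixed -scalerDr scale_half_double.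
  by have -> : h = y + y - y * y by [rewrite yy; nc_ring|]; nc_ring.
- move=> g gh; apply: commrB; first exact: commr1.
  apply: nrm_cvg_unique (nrm_cvgM (nrm_cvg_cst g) y_lim) _.
  rewrite (_ : (fun n => _) = fun n => sqrt_iter n * g).
    exact: nrm_cvgM y_lim (nrm_cvg_cst g).
  by apply/funext => n; exact: comm_sqrt_iter.
Qed.

End SquareRootIteration.

(** * Spectral positivity *)

(* With [e = 0] the bound says that the spectrum of the selfadjoint element [a] lies in
   [[0, 2 t]]; the slack [e] makes the condition closed. *)
Definition spos a := sa a /\
  forall e, 0 < e -> exists2 t, 0 <= t & nrm (t%:C%:A - a) <= t + e.

Lemma spos_selfadjoint a : spos a -> sa a.
Proof. by case. Qed.

Lemma spos_large s a e : spos a -> 0 < e ->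
  exists t, [/\ s <= t, 0 <= t & nrm (t%:C%:A - a) <= t + e].
Proof.
move=> [_ bound] /bound[t t_ge0 at_t]; exists (t + `|s|); split.
- by have := ler_norm s; lra.
- by rewrite addr_ge0.
- rewrite constD addrAC; apply: le_trans (nrmD _ _) _.
  by rewrite nrm_const normr_id; lra.
Qed.

Lemma sposD a b : spos a -> spos b -> spos (a + b).
Proof.
move=> [saa bound_a] [sab bound_b]; split=> [|e e_gt0]; first exact: selfadjointD.
have e2_gt0 : 0 < e / 2 by rewrite divr_gt0.
have [t t_ge0 at_t] := bound_a _ e2_gt0; have [s s_ge0 bs] := bound_b _ e2_gt0.
exists (t + s); first by rewrite addr_ge0.
by rewrite constD opprD addrACA; apply: le_trans (nrmD _ _) _; lra.
Qed.

Lemma sposZ t a : 0 <= t -> spos a -> spos (t%:C *: a).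
Proof.
move=> t_ge0 [saa bound]; split=> [|e e_gt0]; first exact: selfadjointZ.
have [|s s_ge0 as_s] := bound (e / (t + 1)); first by rewrite divr_gt0 //; lra.
exists (t * s); first by rewrite mulr_ge0.
rewrite rmorphM -scalerA -scalerBr nrmZr ger0_norm //.
apply: le_trans (ler_wpM2l t_ge0 as_s) _; rewrite mulrDr lerD2l mulrCA.
by rewrite ger_pMr // ler_pdivrMr; lra.
Qed.

Lemma spos_const t : 0 <= t -> spos t%:C%:A.
Proof.
move=> t_ge0; split=> [|e e_gt0]; first exact: selfadjoint_const.
by exists t => //; rewrite subrr nrm0; lra.
Qed.

Lemma spos0 : spos 0.
Proof. by have := spos_const (lexx 0); rewrite rmorph0 scale0r. Qed.

Lemma spos1 : spos 1.
Proof. by rewrite -const1; exact: spos_const. Qed.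

Lemma sposMn a n : spos a -> spos (a *+ n).
Proof. by move=> a_pos; rewrite mulrn_scale; exact: sposZ. Qed.

Lemma spos_closed a : sa a -> (forall e, 0 < e -> spos (a + e%:C%:A)) -> spos a.
Proof.
move=> saa a_pos; split=> // e e_gt0; have e2_gt0 : 0 < e / 2 by rewrite divr_gt0.
have [_ /(_ _ e2_gt0)[t t_ge0 at_t]] := a_pos _ e2_gt0; exists t => //.
have -> : t%:C%:A - a = t%:C%:A - (a + (e / 2)%:C%:A) + (e / 2)%:C%:A by nc_ring.
by apply: le_trans (nrmD _ _) _; rewrite nrm_const gtr0_norm //; lra.
Qed.

Lemma spos_of_nrm_1B_le1 a : sa a -> nrm (1 - a) <= 1 -> spos a.
Proof.
by move=> saa le1; split=> // e e_gt0; exists 1 => //; rewrite const1; lra.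
Qed.

Lemma spos_nrmB h : sa h -> spos ((nrm h)%:C%:A - h).
Proof.
move=> sah; split=> [|e e_gt0]; first by apply: selfadjointB (selfadjoint_const _) sah.
exists (nrm h); first exact: nrm_ge0.
by rewrite opprB addrCA subrr addr0; lra.
Qed.

Lemma spos_nrmD h : sa h -> spos ((nrm h)%:C%:A + h).
Proof. by move=> /selfadjointN/spos_nrmB; rewrite nrmN opprK. Qed.

Lemma spos_sqrt a e : spos a -> 0 < e -> exists w,
  [/\ sa w, w * w = a + e%:C%:A & forall g, GRing.comm g a -> GRing.comm g w].
Proof.
move=> a_pos e_gt0; have e2_gt0 : 0 < e / 2 by rewrite divr_gt0.
have [t [_ t_ge0 at_t]] := spos_large 0 a_pos e2_gt0.
have te_gt0 : 0 < t + e by lra.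
set h := (t + e)^-1%:C *: (t%:C%:A - a).
have sah : sa h.
  exact: selfadjointZ (selfadjointB (selfadjoint_const _) (spos_selfadjoint a_pos)).
have h_lt1 : nrm h < 1.
  by rewrite nrmZr ger0_norm ?invr_ge0 1?ltW // mulrC ltr_pdivrMr //; lra.
have [w [saw ww w_comm]] := exists_sqrt_1B sah h_lt1.
exists ((Num.sqrt (t + e))%:C *: w); split.
- exact: selfadjointZ.
- rewrite -scalerAl -scalerAr scalerA -rmorphM -expr2 sqr_sqrtr ?(ltW te_gt0) // ww.
  rewrite scalerBr scalerA -rmorphM mulfV ?gt_eqF // rmorph1 scale1r constD.
  by nc_ring.
- by move=> g ga; apply/commrZ/w_comm/commrZ/commrB => //; exact: comm_const.
Qed.

(* [u := h + i (1 - h^2)^(1/2)] is unitary, so that its imaginary part, whose square is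
   [1 - h^2], is a contraction. *)
Lemma spos_sqr h : sa h -> spos (h * h).
Proof.
move=> sah; rewrite -(re_part_selfadjoint sah); move: h {sah}.
apply: homogeneous_unit_ball => [t h t_ge0 h_pos|h h_lt1].
  rewrite re_partZ -scalerAl -scalerAr scalerA -rmorphM.
  by apply: sposZ; rewrite ?mulr_ge0.
have {h_lt1} := le_lt_trans (nrm_re_part h) h_lt1; have := selfadjoint_re_part h.
move: (re_part h) => {}h sah h_lt1.
have hh_lt1 : nrm (h * h) < 1 by rewrite nrm_sqr // expr_lt1 ?nrm_ge0.
have [w [saw ww w_comm]] := exists_sqrt_1B (selfadjoint_sqr sah) hh_lt1.
have hw : h * w = w * h by apply: w_comm; exact: commrM.
set u := h + I *: w; have nrm_u : nrm u = 1.
  apply/eqP; rewrite -(@pexpr_eq1 _ _ 2) ?nrm_ge0 // -(nrm_cstar hA).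
  by rewrite star_mul_cartesian // hw ww subrr scaler0 addr0 addrC subrK nrm1.
apply: spos_of_nrm_1B_le1; first exact: selfadjoint_sqr.
have := nrm_im_part u; rewrite im_part_cartesian // nrm_u -ww nrm_sqr //.
by rewrite expr_le1 ?nrm_ge0.
Qed.

(* If [v^2 = s + e + h] and [w^2 = s + e - h] then [u := v + i w] has
   [u^* u = 2 (s + e)] and [u^2 + (u^2)^* = 4 h]. *)
Lemma nrm_le_of_spos s h : 0 <= s -> sa h ->
  spos (s%:C%:A - h) -> spos (s%:C%:A + h) -> nrm h <= s.
Proof.
move=> s_ge0 sah sB_pos sD_pos; apply/ler_addgt0Pr => e e_gt0.
have [v [sav vv v_comm]] := spos_sqrt sD_pos e_gt0.
have [w [saw ww w_comm]] := spos_sqrt sB_pos e_gt0.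
have vw : v * w = w * v.
  apply/w_comm/commr_sym/v_comm/commrD; first exact: comm_const.
  by apply/commr_sym/commrB => //; exact: comm_const.
set u := v + I *: w.
have uu : star u * u = (s + e)%:C%:A *+ 2.
  by rewrite star_mul_cartesian // vw subrr scaler0 addr0 vv ww constD; nc_ring.
have nrm_u : nrm u ^+ 2 = (s + e) *+ 2.
  by rewrite -(nrm_cstar hA) uu nrmMn nrm_const ger0_norm //; lra.
have hE : h *+ 4 = u * u + star (u * u).
  rewrite starM star_cartesian // -scalerN !sqr_cartesian mulrNN !mulrN !mulNr -opprD.
  rewrite scalerN addrACA subrr addr0 vv ww -[4%N]/(2 * 2)%N mulrnA; nc_ring.
have : nrm (h *+ 4) <= nrm u ^+ 2 *+ 2.
  rewrite hE; apply: le_trans (nrmD _ _) _; rewrite nrm_star -mulr2n lerMn2r /= expr2.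
  exact: nrmM.
by rewrite nrmMn nrm_u; lra.
Qed.

Section SwapFactors.
Variables (x y : A) (s t : R).
Hypotheses (t_gt0 : 0 < t) (s_le : `|s| <= t) (yx_le : nrm (s%:C%:A - y * x) <= t).
Local Notation c := (s%:C%:A : A).
Local Notation d := (c - x * y).

Lemma mul_exprB_swap n : y * d ^+ n = (c - y * x) ^+ n * y.
Proof.
elim: n => [|n IHn]; first by rewrite !expr0 mulr1 mul1r.
rewrite !exprSr mulrA IHn -!mulrA; congr (_ * _).
by rewrite mulrBr mulrBl -scalerAl -scalerAr mul1r mulr1 mulrA.
Qed.

Lemma nrm_exprB_swap n : t * nrm (c ^+ n - d ^+ n) <= nrm x * nrm y * t ^+ n *+ n.
Proof.
have nrm_power k : nrm ((c - y * x) ^+ k) <= t ^+ k.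
  by apply: le_trans (nrmX_le _ _) _; rewrite lerXn2r ?nnegrE ?nrm_ge0 // ltW.
elim: n => [|n IHn]; first by rewrite !expr0 subrr nrm0 mulr0.
have -> : c ^+ n.+1 - d ^+ n.+1 = c * (c ^+ n - d ^+ n) + x * ((c - y * x) ^+ n * y).
  by rewrite -mul_exprB_swap !exprS; nc_ring.
have first_le : nrm (c * (c ^+ n - d ^+ n)) <= t * nrm (c ^+ n - d ^+ n).
  by apply: le_trans (nrmM _ _) _; rewrite ler_wpM2r ?nrm_ge0 // nrm_const.
have second_le : nrm (x * ((c - y * x) ^+ n * y)) <= nrm x * nrm y * t ^+ n.
  apply: le_trans (nrmM _ _) _; rewrite -mulrA ler_wpM2l ?nrm_ge0 // mulrC.
  by apply: le_trans (nrmM _ _) _; rewrite ler_wpM2r ?nrm_ge0.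
rewrite mulrSr exprS mulrCA -mulrnAr -mulrDr ler_pM2l //.
apply: le_trans (nrmD _ _) _; apply: lerD; last exact: second_le.
exact: le_trans first_le IHn.
Qed.

(* The nonzero spectra of [x * y] and [y * x] agree; the proof compares the growth of the
   powers of [c - x * y] and [c - y * x]. *)
Lemma nrm_constB_swap : sa d -> nrm d <= t.
Proof.
move=> sad; rewrite -[leRHS]mul1r -ler_pdivrMr //.
apply: (@le1_of_exprn_le_affine _ _ 1 (nrm x * nrm y / t)) => n.
rewrite expr_div_n ler_pdivrMr ?exprn_gt0 // -nrmX //.
have -> : d ^+ n = c ^+ n - (c ^+ n - d ^+ n) by rewrite subKr.
apply: le_trans (nrmB _ _) _; rewrite mulrDl mul1r; apply: lerD.
  apply: le_trans (nrmX_le _ _) _.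
  by rewrite nrm_const lerXn2r ?nnegrE // ltW.
rewrite -(ler_pM2l t_gt0); apply: le_trans (nrm_exprB_swap n) _.
rewrite -mulr_natr -[(_ / t) *+ n]mulr_natr.
by rewrite le_eqVlt; apply/orP; left; apply/eqP; field; rewrite gt_eqF.
Qed.

End SwapFactors.

Lemma spos_swap y s : 0 <= s ->
  spos (y * star y + s%:C%:A) -> spos (star y * y + s%:C%:A).
Proof.
move=> s_ge0 pos; split=> [|e e_gt0].
  exact: selfadjointD (selfadjoint_star_mul y) (selfadjoint_const s).
have [t [s_le t_ge0 bound]] := spos_large s pos e_gt0; exists t => //.
have constB_E a : t%:C%:A - (a + s%:C%:A) = (t - s)%:C%:A - a by rewrite constB; nc_ring.
rewrite constB_E in bound; rewrite constB_E; apply: (nrm_constB_swap _ _ bound).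
- by lra.
- by rewrite ger0_norm; lra.
- exact: selfadjointB (selfadjoint_const _) (selfadjoint_star_mul y).
Qed.

Lemma spos_star_mulD_mul_star y : spos (star y * y + y * star y).
Proof.
have [sav saw] := (selfadjoint_re_part y, selfadjoint_re_part (- (I *: y))).
rewrite [y]cartesian_decomposition /im_part star_mul_cartesian // mul_star_cartesian //.
by rewrite addrACA addrN addr0; apply: sposD; apply: sposD; exact: spos_sqr.
Qed.

Lemma nrm_star_mul_le s y : 0 <= s -> spos (s%:C%:A - star y * y) -> nrm (star y * y) <= s.
Proof.
move=> s_ge0 pos; apply: nrm_le_of_spos => //; first exact: selfadjoint_star_mul.
rewrite addrC; apply: spos_swap => //.
have := sposD pos (spos_star_mulD_mul_star y); congr spos; nc_ring.
Qed.

(* [1 - M b^M (1 - b) = b^M + (1 - b)^2 (1 + 2 b + ... + M b^(M - 1))] for [b := w^2]. *)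
Lemma spos_1B_exprB w M : sa w ->
  spos (1 - ((w * w) ^+ M - (w * w) ^+ M.+1) *+ M).
Proof.
move=> saw; set b := w * w.
have wb n : GRing.comm (w ^+ n) (1 - b).
  by apply/commr_sym/commrX/commr_sym/commrB; [exact: commr1|exact: commrM].
have bX n : b ^+ n = w ^+ n * w ^+ n by rewrite exprMn_comm.
have b_pos n : spos (b ^+ n) by rewrite bX; apply/spos_sqr/selfadjointX.
have sab : sa (1 - b) by apply: selfadjointB selfadjoint1 (selfadjoint_sqr saw).
suff : spos (1 - (b ^+ M - b ^+ M.+1) *+ M - b ^+ M).
  by move=> /sposD/(_ (b_pos M)); rewrite subrK.
elim: M => [|M IHM]; first by rewrite mulr0n subr0 expr0 subrr; exact: spos0.
have square_pos : spos ((1 - b) * (1 - b) * b ^+ M).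
  rewrite bX mulrA.
  have -> : (1 - b) * (1 - b) * w ^+ M * w ^+ M = w ^+ M * (1 - b) * (w ^+ M * (1 - b)).
    by rewrite wb !mulrA -(mulrA (1 - b) _ (1 - b)) wb !mulrA.
  by apply/spos_sqr/selfadjointM => //; exact: selfadjointX.
have := sposD IHM (sposMn M.+1 square_pos); congr spos.
rewrite !exprS; set p := b ^+ M; rewrite !mulrnBl -!mulrnAr !mulrS.
by nc_ring.
Qed.

(* Replaces the negative part of [a = x^* x] in the classical argument: with [b = 1 - a],
   [y = x b^N] satisfies [y^* y = b^(2 N) - b^(2 N + 1) <= 1 / (2 N)], hence also
   [nrm (y^* y) <= 1 / (2 N)], which is impossible for large [N] if [nrm b > 1]. *)
Lemma nrm_1B_star_mul_le1 x : nrm x < 1 -> nrm (1 - star x * x) <= 1.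
Proof.
move=> x_lt1; have saa := selfadjoint_star_mul x; set a := star x * x in saa *.
have a_lt1 : nrm a < 1 by rewrite (nrm_cstar hA) expr_lt1 ?nrm_ge0.
have [w [saw ww _]] := exists_sqrt_1B saa a_lt1; set b := 1 - a in ww *.
have sab : sa b by exact: selfadjointB selfadjoint1 saa.
rewrite leNgt; apply/negP => b_gt1; suff : 0 <= 1 - nrm b by lra.
apply: (@ge0_of_affine_ge0 _ _ 1) => n; set M := (n.+1 + n.+1)%N.
have M_gt0 : 0 < M%:R :> R by rewrite ltr0n.
have b_powers : star (x * b ^+ n.+1) * (x * b ^+ n.+1) = b ^+ M - b ^+ M.+1.
  rewrite starM (selfadjointX _ sab) mulrA -(mulrA _ (star x)) -/a.
  have -> : a = 1 - b by rewrite /b subKr.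
  by rewrite mulrBr mulr1 -exprSr mulrBl -!exprD.
have nrm_le : nrm (b ^+ M - b ^+ M.+1) <= M%:R^-1.
  rewrite -b_powers; apply: nrm_star_mul_le; rewrite ?invr_ge0 // b_powers -ww.
  have M_inv_ge0 : 0 <= (M%:R^-1 : R) by rewrite invr_ge0.
  have := sposZ M_inv_ge0 (spos_1B_exprB M saw); congr spos.
  rewrite scalerBr; congr (_ - _).
  by rewrite mulrn_scale scalerA -rmorphM mulVf ?gt_eqF // rmorph1 scale1r.
have : nrm (b ^+ M.+1) <= nrm (b ^+ M) + nrm (b ^+ M - b ^+ M.+1).
  by have := nrmB (b ^+ M) (b ^+ M - b ^+ M.+1); rewrite opprB addrCA subrr addr0.
rewrite !nrmX // exprSr => growth.
have le_growth : nrm b - 1 <= nrm b ^+ M * (nrm b - 1).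
  by rewrite ler_peMl ?subr_ge0 ?exprn_ege1 // ltW.
have : (nrm b - 1) * M%:R <= 1 by rewrite -ler_pdivlMr // div1r; lra.
have : (nrm b - 1) * n.+1%:R <= (nrm b - 1) * M%:R.
  by rewrite ler_wpM2l ?ler_nat ?leq_addl // subr_ge0 ltW.
rewrite -mulr_natr; lra.
Qed.

Lemma spos_star_mul x : spos (star x * x).
Proof.
move: x; apply: homogeneous_unit_ball => [t x t_ge0 x_pos|x x_lt1].
  rewrite starZr -scalerAl -scalerAr scalerA -rmorphM.
  by apply: sposZ; rewrite ?mulr_ge0.
exact: spos_of_nrm_1B_le1 (selfadjoint_star_mul x) (nrm_1B_star_mul_le1 x_lt1).
Qed.

(** * States *)

Section StateTheory.
Variable phi : A -> R[i].
Hypothesis phi_state : is_state star phi.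

Lemma state_is_scalar : scalar phi.
Proof. by case: phi_state. Qed.

Definition state_functional : {scalar A} :=
  HB.pack phi (GRing.isLinear.Build R[i] A R[i] *%R phi state_is_scalar).

Lemma state1 : phi 1 = 1.
Proof. by case: phi_state. Qed.

Lemma stateD x y : phi (x + y) = phi x + phi y.
Proof. exact: (linearD state_functional). Qed.

Lemma stateZ (c : R[i]) x : phi (c *: x) = c * phi x.
Proof. exact: (linearZ_LR state_functional). Qed.

Lemma stateN x : phi (- x) = - phi x.
Proof. exact: (linearN state_functional). Qed.

Lemma stateB x y : phi (x - y) = phi x - phi y.
Proof. exact: (linearB state_functional). Qed.

Lemma state0 : phi 0 = 0.
Proof. exact: (linear0 state_functional). Qed.

Lemma stateMn x n : phi (x *+ n) = phi x *+ n.
Proof. exact: (linearMn state_functional). Qed.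

Lemma state_const t : phi t%:C%:A = t%:C.
Proof. by rewrite stateZ state1 mulr1. Qed.

Lemma state_star_mul_ge0 x : 0 <= phi (star x * x).
Proof. by case: phi_state. Qed.

End StateTheory.

Definition state_nonneg p := forall phi, is_state star phi -> 0 <= phi p.

Lemma state_nonnegD p q : state_nonneg p -> state_nonneg q -> state_nonneg (p + q).
Proof.
move=> p_ge0 q_ge0 phi phi_state; rewrite (stateD phi_state).
by apply: addr_ge0; [exact: p_ge0|exact: q_ge0].
Qed.

Lemma state_nonnegZ t p : 0 <= t -> state_nonneg p -> state_nonneg (t%:C *: p).
Proof.
move=> t_ge0 p_ge0 phi phi_state; rewrite (stateZ phi_state).
by apply: mulr_ge0; [rewrite lecR|exact: p_ge0].
Qed.

Lemma state_nonneg_star_mul x : state_nonneg (star x * x).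
Proof. by move=> phi /state_star_mul_ge0; apply. Qed.

Lemma state_nonneg_sqr x : sa x -> state_nonneg (x * x).
Proof. by move=> sax; rewrite -{1}sax; exact: state_nonneg_star_mul. Qed.

Lemma state_nonneg_of_affine p q :
  (forall n, state_nonneg (p *+ n.+1 + q)) -> state_nonneg p.
Proof.
move=> affine_ge0 phi phi_state; apply: (@complex_ge0_of_affine_ge0 _ _ (phi q)) => n.
by have := affine_ge0 n phi phi_state; rewrite (stateD phi_state) (stateMn phi_state).
Qed.

Lemma state_nonneg_pmulrn p n : (0 < n)%N -> state_nonneg (p *+ n) -> state_nonneg p.
Proof.
move=> n_gt0 pn_ge0 phi phi_state; rewrite -(pmulrn_lge0 _ n_gt0) -(stateMn phi_state).
exact: pn_ge0.
Qed.

Lemma state_nonneg_of_spos a : spos a -> state_nonneg a.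
Proof.
move=> a_pos; apply: (@state_nonneg_of_affine _ 1) => n.
have inv_gt0 : 0 < n.+1%:R^-1 :> R by rewrite invr_gt0.
have [w [saw ww _]] := spos_sqrt a_pos inv_gt0.
have -> : a *+ n.+1 + 1 = (n.+1%:R : R)%:C *: (w * w).
  rewrite ww mulrn_scale scalerDr scalerA -rmorphM mulfV ?pnatr_eq0 //.
  by rewrite rmorph1 scale1r.
by apply: state_nonnegZ => //; exact: state_nonneg_sqr.
Qed.

Section StateBounds.
Variable phi : A -> R[i].
Hypothesis phi_state : is_state star phi.

Lemma state_selfadjoint_bounds h : sa h -> - (nrm h)%:C <= phi h <= (nrm h)%:C.
Proof.
move=> sah; have := state_nonneg_of_spos (spos_nrmD sah) phi_state.
have := state_nonneg_of_spos (spos_nrmB sah) phi_state.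
rewrite (stateB phi_state) (stateD phi_state) state_const // subr_ge0 => -> /=.
by rewrite -lerBlDl sub0r andbT.
Qed.

Lemma state_selfadjoint_real h : sa h -> phi h \is Num.real.
Proof.
move=> /state_selfadjoint_bounds /andP[_ /ger_real <-].
by rewrite realE !lecR nrm_ge0.
Qed.

Lemma state_selfadjoint_cabs h : sa h -> cabs (phi h) <= nrm h.
Proof.
move=> sah; rewrite -lecR cabsE real_ler_norml ?state_selfadjoint_bounds //.
exact: state_selfadjoint_real.
Qed.

Lemma state_star x : phi (star x) = (phi x)^*.
Proof.
rewrite [x]cartesian_decomposition /im_part.
have [] := (selfadjoint_re_part x, selfadjoint_re_part (- (I *: x))).
move: (re_part _) (re_part _) => v w sav saw; rewrite star_cartesian //.
rewrite (stateB phi_state) (stateD phi_state) !(stateZ phi_state) rmorphD rmorphM /=.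
by rewrite conj_imaginary !(CrealP (state_selfadjoint_real _)) // mulNr.
Qed.

Lemma state_cabs_le x : cabs (phi x) <= nrm x *+ 2.
Proof.
rewrite -lecR cabsE rmorphMn [x in phi x]cartesian_decomposition.
rewrite (stateD phi_state) (stateZ phi_state).
apply: le_trans (ler_normD _ _) _; rewrite normrM -[`|I|]cabsE cabs_i mul1r mulr2n.
have part_le y : sa y -> nrm y <= nrm x -> `|phi y| <= (nrm x)%:C.
  move=> say y_le; rewrite -cabsE lecR; exact: le_trans (state_selfadjoint_cabs say) y_le.
apply: lerD; apply: part_le; try exact: selfadjoint_re_part.
- exact: nrm_re_part.
- exact: nrm_im_part.
Qed.

End StateBounds.

Lemma state_of_positive_functional (f : {scalar real_scalars A}) :
    (forall x, spos (re_part x) -> 0 <= f x) -> f 1 = 1 ->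
  is_state star (complex_extension f).
Proof.
move=> f_pos f1.
have fi_eq0 p : sa p -> f (I *: p) = 0.
  move=> sap; have : 0 <= f (I *: p).
    by apply: f_pos; rewrite re_part_imaginary //; exact: spos0.
  have : 0 <= f (I *: - p).
    by apply: f_pos; rewrite re_part_imaginary; [exact: spos0|exact: selfadjointN].
  by rewrite scalerN [f (- _)](linearN f); lra.
split; first exact: complex_extension_is_scalar.
- move=> x; have sap := selfadjoint_star_mul x.
  rewrite /complex_extension fi_eq0 // oppr0 lecE /= eqxx /=.
  by apply: f_pos; rewrite re_part_selfadjoint //; exact: spos_star_mul.
- by rewrite /complex_extension fi_eq0 ?f1 ?oppr0 //; exact: selfadjoint1.
Qed.

Lemma spos_of_state_nonneg h : sa h -> state_nonneg h -> spos h.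
Proof.
move=> sah h_ge0; apply: spos_closed => // e e_gt0; apply: contrapT => h_e_not_pos.
pose K : set (real_scalars A) := [set x | spos (re_part x)].
have K_cone : convex_cone K.
  split=> [x y Kx Ky|t x t_ge0 Kx]; rewrite /K /=.
    by rewrite re_partD; exact: sposD.
  by rewrite re_partZ; exact: sposZ.
have K1 : K (1 : A).
  by rewrite /K /= (re_part_selfadjoint selfadjoint1); exact: spos1.
have K_unit x : exists t, K (t%:C%:A - x).
  exists (nrm (re_part x)).
  rewrite /K /= re_partB (re_part_selfadjoint (selfadjoint_const _)).
  exact/spos_nrmB/selfadjoint_re_part.
have K_h : ~ K (h + e%:C%:A).
  by rewrite /K /= re_part_selfadjoint //; apply: selfadjointD (selfadjoint_const _).
have [f [f_pos f1 f_h]] := cone_separation K_cone K1 K_unit K_h.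
have phi_state := state_of_positive_functional f_pos f1.
have := h_ge0 _ phi_state; rewrite lecE /= => /andP[_ /= fh_ge0].
move: f_h; rewrite [f (_ + _)](linearD f) [f (e%:C%:A)](linearZ_LR f) f1 /=; lra.
Qed.

Lemma state_nonneg_antisym h : sa h -> state_nonneg h -> state_nonneg (- h) -> h = 0.
Proof.
move=> sah h_ge0 Nh_ge0; apply: (nrm_eq0 hA); apply/eqP; rewrite eq_le nrm_ge0 andbT.
apply: nrm_le_of_spos => //; rewrite rmorph0 scale0r add0r.
  by apply: spos_of_state_nonneg => //; exact: selfadjointN.
exact: spos_of_state_nonneg.
Qed.

Lemma states_separate x : (forall phi, is_state star phi -> phi x = 0) -> x = 0.
Proof.
move=> x0; have re_part_eq0 z :
    (forall phi, is_state star phi -> phi z = 0) -> re_part z = 0.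
  move=> z0; have phi_re0 phi : is_state star phi -> phi (re_part z) = 0.
    move=> phi_state; rewrite (stateZ phi_state) (stateD phi_state).
    by rewrite (state_star phi_state) z0 // rmorph0 addr0 mulr0.
  apply: state_nonneg_antisym (selfadjoint_re_part z) _ _ => phi phi_state.
    by rewrite phi_re0.
  by rewrite (stateN phi_state) phi_re0 // oppr0.
rewrite [x]cartesian_decomposition (re_part_eq0 x x0) /im_part re_part_eq0.
  by rewrite scaler0 addr0.
by move=> phi phi_state; rewrite (stateN phi_state) (stateZ phi_state) x0 // mulr0 oppr0.
Qed.

(* If [f 1 = 0] then [f] is not a multiple of a state; this is why a multiple of the
   given state is added to [f] before normalizing. *)
Lemma positive_functional_ge0 phi (f : A -> R[i]) p : is_state star phi ->
  scalar f -> (forall x, 0 <= f (star x * x)) -> state_nonneg p -> 0 <= f p.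
Proof.
move=> phi_state f_scalar f_pos p_ge0.
have f1_ge0 : 0 <= f 1 by have := f_pos 1; rewrite star1 mulr1.
apply: (@complex_ge0_of_affine_ge0 _ _ (phi p)) => n; set m := n.+1.
have mass_gt0 : 0 < f 1 *+ m + 1 by rewrite ltr_wpDl ?mulrn_wge0.
suff : is_state star (fun x => (f 1 *+ m + 1)^-1 * (f x *+ m + phi x)).
  by move=> /p_ge0; rewrite pmulr_rge0 // invr_gt0.
split=> [a x y|x|].
- rewrite f_scalar (stateD phi_state) (stateZ phi_state) mulrnDl -mulrnAr; ring.
- rewrite mulr_ge0 ?invr_ge0 ?(ltW mass_gt0) // addr_ge0 ?mulrn_wge0 //.
  exact: state_star_mul_ge0.
- by rewrite (state1 phi_state) mulVf // gt_eqF.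
Qed.

Lemma state_nonneg_conjugate y p : state_nonneg p -> state_nonneg (star y * p * y).
Proof.
move=> p_ge0 phi phi_state; pose f x := phi (star y * x * y).
apply: (positive_functional_ge0 (f := f) phi_state) => // [a x z|x]; rewrite /f.
- rewrite mulrDr mulrDl -scalerAr -scalerAl.
  by rewrite (stateD phi_state) (stateZ phi_state).
- have := state_star_mul_ge0 phi_state (x * y).
  by rewrite starM !mulrA.
Qed.

Lemma state_nonneg_bernstein_monomial g i j : sa g -> nrm g < 1 ->
  let h := (2^-1 : R)%:C *: (1 + g) in state_nonneg (h ^+ i * (1 - h) ^+ j).
Proof.
move=> sag g_lt1 h; have Ng_lt1 : nrm (- g) < 1 by rewrite nrmN.
have [v [sav vv v_comm]] := exists_sqrt_1B (selfadjointN sag) Ng_lt1.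
have [w [saw ww w_comm]] := exists_sqrt_1B sag g_lt1.
have vw : GRing.comm v w by apply/w_comm/commr_sym/v_comm/commrN.
have vw_powers : GRing.comm (v ^+ i) (w ^+ j).
  exact: commrX (commr_sym (commrX _ (commr_sym vw))).
have hE : h = (2^-1 : R)%:C *: (v * v) by rewrite vv opprK.
have h'E : 1 - h = (2^-1 : R)%:C *: (w * w).
  rewrite ww -[X in X - _](scale_half_double 1) -scalerBr.
  by have -> : 1 + 1 - (1 + g) = 1 - g by nc_ring.
have -> : h ^+ i * (1 - h) ^+ j =
    ((2^-1) ^+ i * (2^-1) ^+ j : R)%:C *: ((v ^+ i * w ^+ j) * (v ^+ i * w ^+ j)).
  rewrite h'E hE !exprZn -scalerAl -scalerAr scalerA -!rmorphXn -rmorphM; congr (_ *: _).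
  rewrite !exprMn_comm // -!mulrA; congr (_ * _).
  by rewrite !mulrA vw_powers.
apply: state_nonnegZ; first by rewrite mulr_ge0 ?exprn_ge0 ?invr_ge0.
apply/state_nonneg_sqr/selfadjointM; [by []|exact: selfadjointX..].
Qed.

(** * The numerical radius *)

Lemma state_le_numrad phi x : is_state star phi -> cabs (phi x) <= numrad star x.
Proof.
move=> phi_state; apply: ub_le_sup; last by exists phi.
by exists (nrm x *+ 2) => _ [psi [psi_state ->]]; exact: state_cabs_le.
Qed.

(* [0 <= t] is there for an algebra without states, whose supremum is [sup set0 = 0]. *)
Lemma numrad_le x t : 0 <= t ->
  (forall phi, is_state star phi -> cabs (phi x) <= t) -> numrad star x <= t.
Proof.
move=> t_ge0 le_t; rewrite /numrad; set S := [set _ | _].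
have [->|/set0P S_neq0] := eqVneq S set0; first by rewrite sup0.
by apply: ge_sup => // _ [phi [phi_state ->]]; exact: le_t.
Qed.

Lemma numrad_ge0 x : 0 <= numrad star x.
Proof.
rewrite /numrad; set S := [set _ | _].
have [->|/set0P[_ [phi [phi_state _]]]] := eqVneq S set0; first by rewrite sup0.
exact: le_trans (cabs_ge0 _) (state_le_numrad x phi_state).
Qed.

Lemma numrad0 : numrad star 0 = 0.
Proof.
apply/eqP; rewrite eq_le numrad_ge0 andbT; apply: numrad_le => // phi phi_state.
by rewrite (state0 phi_state) -(rmorph0 (real_complex R)) cabs_real normr0.
Qed.

Lemma numrad_eq0 x : numrad star x = 0 -> x = 0.
Proof.
move=> x0; apply: states_separate => phi phi_state; apply: cabs_eq0; apply/eqP.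
by rewrite eq_le cabs_ge0 andbT -x0 state_le_numrad.
Qed.

Lemma numrad_shift_le p t : sa p -> state_nonneg p ->
  numrad star (((- (nrm p / 2)) +i* t)%C%:A + p) ^+ 2 <= (nrm p / 2) ^+ 2 + t ^+ 2.
Proof.
move=> sap p_ge0; set m := _ + t ^+ 2; have m_ge0 : 0 <= m by rewrite addr_ge0 ?sqr_ge0.
rewrite -(sqr_sqrtr m_ge0) ler_sqr ?nnegrE ?sqrtr_ge0 ?numrad_ge0 //.
apply: numrad_le => [|phi phi_state]; first exact: sqrtr_ge0.
rewrite -ler_sqr ?nnegrE ?sqrtr_ge0 ?cabs_ge0 // sqr_sqrtr // cabs_sqr.
rewrite (stateD phi_state) (stateZ phi_state) (state1 phi_state) mulr1.
have := p_ge0 _ phi_state; have /andP[_] := state_selfadjoint_bounds phi_state sap.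
rewrite !lecE; case: (phi p) => a b /= /andP[/eqP <- a_le] /andP[_ a_ge0].
have : 0 <= a * (nrm p - a) by rewrite mulr_ge0 // subr_ge0.
by rewrite /m addr0; lra.
Qed.

Lemma state_of_le_numrad (f : A -> R[i]) : scalar f -> f 1 = 1 ->
  (forall x, cabs (f x) <= numrad star x) -> is_state star f.
Proof.
move=> f_scalar f1 f_le; split=> // x; set p := star x * x.
have discs t : (complex.Re (f p) - nrm p / 2) ^+ 2 + (complex.Im (f p) + t) ^+ 2 <=
    (nrm p / 2) ^+ 2 + t ^+ 2.
  have sap : sa p := selfadjoint_star_mul x.
  apply: le_trans (numrad_shift_le t sap (@state_nonneg_star_mul x)).
  have := f_le (((- (nrm p / 2)) +i* t)%C%:A + p).
  rewrite -ler_sqr ?nnegrE ?cabs_ge0 ?numrad_ge0 // cabs_sqr f_scalar f1 mulr1.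
  by case: (f p) => a b /=; rewrite [a - _]addrC [b + _]addrC.
have [Im_eq0 /andP[Re_ge0 _]] := in_segment_of_in_discs (nrm_ge0 p) discs.
by rewrite lecE Im_eq0 eqxx.
Qed.

End CstarAlgebra.

(** * Kadison's inequality *)

Definition pulls_back_states (R : realType) (A B : algType R[i])
    (starA : A -> A) (starB : B -> B) (T : A -> B) :=
  forall phi, is_state starB phi -> is_state starA (phi \o T).

Definition sqr_defect (A B : pzRingType) (T : A -> B) (x : A) : B := T (x * x) - T x * T x.

Section LinearMaps.
Variables (R : realType) (A B : algType R[i]) (T : {linear A -> B}).
Implicit Types (h x y : A) (X : B).

Lemma sqr_defectZ (c : R[i]) x : sqr_defect T (c *: x) = c ^+ 2 *: sqr_defect T x.
Proof.
rewrite /sqr_defect !linearZ -!scalerAl -!scalerAr !linearZ /= !scalerA -expr2.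
by rewrite -scalerDr.
Qed.

Lemma sqr_defect_shift (c : R[i]) x : T 1 = 1 -> sqr_defect T (c%:A + x) = sqr_defect T x.
Proof.
move=> T1; rewrite /sqr_defect !(mulrDl, mulrDr) !mulr_algl !mulr_algr !linearD !linearZ /=.
by rewrite T1 !(mulrDl, mulrDr) !mulr_algl !mulr_algr; nc_ring.
Qed.

Lemma map_anticommutator x y :
    (forall z, z \in [:: x; y; x + y] -> T (z * z) = T z * T z) ->
  T (x * y + y * x) = T x * T y + T y * T x.
Proof.
move=> T_sqr; have -> : x * y + y * x = (x + y) * (x + y) - x * x - y * y by nc_ring.
by rewrite !linearB !T_sqr ?inE ?eqxx ?orbT // linearD; nc_ring.
Qed.

(* With [p_l := 'C(n, l) h^l (1 - h)^(n - l)] this is the closed form of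
   [\sum_l (k + l - X) * T (q * p_l) * (k + l - X)]; the recursion in [n] below is
   Pascal's rule. *)
Definition bernstein_form h X n q k :=
  let m := k%:R + h *+ n in
  T (q * (m * m + h *+ n - h *+ n * h)) - X * T (q * m) - T (q * m) * X + X * T q * X.

Lemma bernstein_form0 h X q k :
  bernstein_form h X 0 q k = (k%:R - X) * T q * (k%:R - X).
Proof.
have T_natr x : T (x * k%:R) = T x * k%:R by rewrite !mulr_natr linearMn.
rewrite /bernstein_form !mulr0n mul0r subr0 !addr0 mulrA !T_natr.
by rewrite mulrBl -(commr_nat (T q) k) !mulrBr; nc_ring.
Qed.

Lemma bernstein_formS h X n q k : bernstein_form h X n.+1 q k =
  bernstein_form h X n (q * (1 - h)) k + bernstein_form h X n (q * h) k.+1.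
Proof.
rewrite /bernstein_form mulrSr -natr1.
set H := h *+ n; rewrite [k%:R + (H + h)]addrA; set m := k%:R + H.
have mh : m * h = h * m.
  by apply/commr_sym/commrD; [exact: commr_nat|exact: commrMn].
rewrite [k%:R + 1 + _]addrAC -/m.
have -> : (m + h) * (m + h) + (H + h) - (H + h) * h =
    (1 - h) * (m * m + H - H * h) + h * ((m + 1) * (m + 1) + H - H * h).
  transitivity ((1 - h) * (m * m + H - H * h) + h * ((m + 1) * (m + 1) + H - H * h)
    + (m * h - h * m)); first by nc_ring.
  by rewrite mh subrr addr0.
have -> : m + h = (1 - h) * m + h * (m + 1) by nc_ring.
have T_split u v : T (q * ((1 - h) * u + h * v)) = T (q * (1 - h) * u) + T (q * h * v).
  by rewrite mulrDr linearD !mulrA.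
have -> : T q = T (q * (1 - h)) + T (q * h) by rewrite -linearD -mulrDr subrK mulr1.
by rewrite !T_split; nc_ring.
Qed.

Lemma bernstein_form_variance h n : T 1 = 1 -> bernstein_form h (T h *+ n) n 1 0 =
  (sqr_defect T h *+ n + T (h - h * h)) *+ n.
Proof.
move=> T1; rewrite /bernstein_form add0r !mul1r T1 mulr1 linearMn addrNK.
have -> : h *+ n * (h *+ n) + h *+ n - h *+ n * h = ((h * h) *+ n + (h - h * h)) *+ n.
  by rewrite mulrnAl mulrnAr mulrnAl mulrnDl mulrnBl addrA.
rewrite linearMn linearD linearMn mulrnAl mulrnAr -mulrnBl; congr (_ *+ _).
by rewrite /sqr_defect mulrnBl addrAC.
Qed.

End LinearMaps.

Section PositiveUnitalMaps.
Variables (R : realType) (A B : algType R[i]).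
Variables (starA : A -> A) (nrmA : A -> R) (starB : B -> B) (nrmB : B -> R).
Hypotheses (hA : is_cstar_alg starA nrmA) (hB : is_cstar_alg starB nrmB).
Variable T : {linear A -> B}.
Hypothesis T1 : T 1 = 1.
Implicit Types (h x y : A) (X : B).

Lemma pulls_back_states_of_numrad_le :
  (forall x, numrad starB (T x) <= numrad starA x) -> pulls_back_states starA starB T.
Proof.
move=> T_le phi phi_state; apply: (state_of_le_numrad hA) => [a x y||x] /=.
- by case: phi_state => phi_lin _ _; rewrite linearP phi_lin.
- by rewrite T1 (state1 phi_state).
- exact: le_trans (state_le_numrad hB _ phi_state) (T_le x).
Qed.

Hypothesis T_states : pulls_back_states starA starB T.

Lemma state_nonneg_map p : state_nonneg starA p -> state_nonneg starB (T p).
Proof. by move=> p_ge0 phi /T_states; exact: p_ge0. Qed.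

Lemma map_star x : T (starA x) = starB (T x).
Proof.
apply/eqP; rewrite -subr_eq0; apply/eqP/(states_separate hB) => phi phi_state.
rewrite (stateB phi_state) (state_star hB phi_state).
by rewrite -(state_star hA (T_states phi_state)) subrr.
Qed.

Lemma selfadjoint_map h : selfadjoint starA h -> selfadjoint starB (T h).
Proof. by rewrite /selfadjoint -map_star => ->. Qed.

Lemma selfadjoint_sqr_defect h :
  selfadjoint starA h -> selfadjoint starB (sqr_defect T h).
Proof.
move=> sah; apply: (selfadjointB hB).
- exact/selfadjoint_map/(selfadjoint_sqr hA).
- exact/(selfadjoint_sqr hB)/selfadjoint_map.
Qed.

Lemma state_nonneg_bernstein_form h X n i j k : selfadjoint starB X ->
    (forall i j, state_nonneg starA (h ^+ i * (1 - h) ^+ j)) ->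
  state_nonneg starB (bernstein_form T h X n (h ^+ i * (1 - h) ^+ j) k).
Proof.
move=> saX monomial_ge0; elim: n i j k => [|n IHn] i j k.
  have sa_kX : starB (k%:R - X) = k%:R - X.
    exact: (selfadjointB hB (selfadjointMn hB _ (selfadjoint1 hB)) saX).
  rewrite bernstein_form0 -{1}sa_kX.
  exact/(state_nonneg_conjugate hB)/state_nonneg_map/monomial_ge0.
rewrite bernstein_formS; apply: (state_nonnegD _ _).
- by rewrite -mulrA -exprSr; exact: IHn.
- have -> : h ^+ i * (1 - h) ^+ j * h = h ^+ i.+1 * (1 - h) ^+ j.
    rewrite -mulrA exprSr -mulrA; congr (_ * _); apply/esym/commrX/commrB => //.
    exact: commr1.
  exact: IHn.
Qed.

Lemma kadison_inequality h :
  selfadjoint starA h -> state_nonneg starB (sqr_defect T h).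
Proof.
move=> sah; rewrite -(re_part_selfadjoint sah); move: h {sah}.
apply: (homogeneous_unit_ball hA) => [t h t_ge0|h h_lt1].
  rewrite (re_partZ hA) sqr_defectZ -rmorphXn; apply: state_nonnegZ; exact: sqr_ge0.
have {h_lt1} := le_lt_trans (nrm_re_part hA h) h_lt1.
have := selfadjoint_re_part hA h; move: (re_part starA h) => g sag g_lt1.
set c : R[i] := (2^-1 : R)%:C; set b := c *: (1 + g).
have b_sa : selfadjoint starA b.
  exact: (selfadjointZ hA) (selfadjointD hA (selfadjoint1 hA) sag).
suff : state_nonneg starB (sqr_defect T b).
  rewrite /b scalerDr sqr_defect_shift // sqr_defectZ -rmorphXn.
  have four_ge0 : 0 <= 4 :> R by [].
  move=> /(state_nonnegZ four_ge0).
  by rewrite scalerA -rmorphM (_ : 4 * _ = 1) ?rmorph1 ?scale1r //; field.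
apply: (state_nonneg_of_affine (q := T (b - b * b))) => n.
apply: (state_nonneg_pmulrn (ltn0Sn n)); rewrite -bernstein_form_variance //.
have -> : (1 : A) = b ^+ 0 * (1 - b) ^+ 0 by rewrite !expr0 mulr1.
apply: state_nonneg_bernstein_form => [|i j].
- exact/(selfadjointMn hB)/selfadjoint_map.
- exact: (state_nonneg_bernstein_monomial hA).
Qed.

End PositiveUnitalMaps.

(** * Jordan isomorphisms *)

Section OrderIsomorphism.
Variables (R : realType) (A B : algType R[i]).
Variables (starA : A -> A) (nrmA : A -> R) (starB : B -> B) (nrmB : B -> R).
Hypotheses (hA : is_cstar_alg starA nrmA) (hB : is_cstar_alg starB nrmB).
Variables (T : {linear A -> B}) (S : {linear B -> A}).
Hypotheses (T1 : T 1 = 1) (TK : cancel T S) (SK : cancel S T).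
Hypotheses (T_states : pulls_back_states starA starB T)
  (S_states : pulls_back_states starB starA S).

Lemma order_iso_sqr_selfadjoint h : selfadjoint starA h -> T (h * h) = T h * T h.
Proof.
move=> sah; apply/eqP; rewrite -subr_eq0; apply/eqP.
apply: (state_nonneg_antisym hB).
- exact: (selfadjoint_sqr_defect hA hB).
- exact: (kadison_inequality hA hB).
have S1 : S 1 = 1 by rewrite -T1 TK.
have := kadison_inequality hB hA S1 S_states (selfadjoint_map hA hB T_states sah).
by move=> /(state_nonneg_map T_states); rewrite /sqr_defect linearB SK TK opprB.
Qed.

Lemma order_iso_sqr x : T (x * x) = T x * T x.
Proof.
rewrite [x](cartesian_decomposition hA) /im_part.
have [] := (selfadjoint_re_part hA x, selfadjoint_re_part hA (- ('i%C *: x))).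
move: (re_part _ _) (re_part _ _) => p q sap saq.
rewrite linearD linearZ /= !sqr_cartesian linearD linearB linearZ /=.
rewrite !order_iso_sqr_selfadjoint // map_anticommutator // => z.
rewrite !inE => /or3P[] /eqP->; apply: order_iso_sqr_selfadjoint => //.
exact: (selfadjointD hA).
Qed.

Lemma order_iso_jordan : jordan_star_iso starA starB T.
Proof.
split.
- by exists S.
- exact: linearP.
- exact: (map_star hA hB T_states).
- move=> x y; rewrite /jprod linearZ /= map_anticommutator // => z _.
  exact: order_iso_sqr.
Qed.

End OrderIsomorphism.

Unset Implicit Arguments.
Set Strict Implicit.

Theorem theorem5p1 (R : realType) (A B : algType R[i])
    (starA : A -> A) (nrmA : A -> R) (starB : B -> B) (nrmB : B -> R)
    (hA : is_cstar_alg starA nrmA) (hB : is_cstar_alg starB nrmB)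
    (T : A -> B)
    (hlin : forall (a : R[i]) x y, T (a *: x + y) = a *: T x + T y)
    (hunit : T 1 = 1)
    (hsurj : forall y : B, exists x : A, T x = y)
    (hnu : forall x : A, numrad starB (T x) = numrad starA x) :
  jordan_star_iso starA starB T.
Proof.
pose linT : {linear A -> B} := HB.pack T (GRing.isLinear.Build R[i] A B *:%R T hlin).
have [S SK] := choice hsurj.
have TK : cancel T S.
  move=> x; apply/eqP; rewrite -subr_eq0; apply/eqP/(numrad_eq0 hA).
  by rewrite -hnu [T _](linearB linT) /= SK subrr (numrad0 hB).
pose linS : {linear B -> A} := HB.pack S
  (GRing.isLinear.Build R[i] B A *:%R S (can2_linear (f := linT) TK SK)).
apply: (@order_iso_jordan _ _ _ _ _ _ _ hA hB linT linS) => //.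
- by apply: (pulls_back_states_of_numrad_le hA hB) => // x; rewrite hnu.
- apply: (pulls_back_states_of_numrad_le hB hA) => [|y] /=; first by rewrite -hunit TK.
  by rewrite -hnu SK.
Qed.
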